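(* Let $n\ge2$ and let $S_1,\ldots,S_n$ be (nonempty) perfect subsets of $\mathbb{R}$ such that $\mathbb{Q}\cap S_k$ is dense in $S_k$ for each $k\in\{1,2\}$. Let $S=\prod_{j=1}^nS_j\subset\mathbb{R}^n$. Then $S$ is a nonempty locally closed set and there are collections $\{L_i\}$, $\{L'_j\}$, $\{A_i\}$ forming a Khintchine system for $S$ (defined in the context). In particular: (1) for every $\Phi:\mathbb{Z}^n\smallsetminus\{\boldsymbol{0}\}\to\mathbb{R}_+$ such that $\{\boldsymbol{q}:\Phi(\boldsymbol{q})\le C\}$ is finite for every $C>0$, and every non-increasing $\varphi:\mathbb{R}_+\to\mathbb{R}_+$, there exist uncountably many totally irrational $\boldsymbol{\xi}\in S$ such that $\psi_{\Phi,\boldsymbol{\xi}}(t)\le\varphi(t)$ for all large enough $t$; (2) there exist uncountably many totally irrational $\boldsymbol{\xi}\in S$ with $\hat{\omega}^*(\boldsymbol{\xi})=\infty$; (3) there exist uncountably many totally irrational $\boldsymbol{\xi}\in S$ with $\hat{\omega}(\boldsymbol{\xi})\ge\frac1{n-1}$; (4) for every $\boldsymbol{s}=(s_1,\ldots,s_n)\in(0,1)^n$ with $\sum_js_j=1$, there exist uncountably many totally irrational $\boldsymbol{\xi}\in S$ with $\hat{\omega}^*_{\boldsymbol{s}}(\boldsymbol{\xi})=\infty$; (5) for every such $\boldsymbol{s}$, with $\delta=\min_js_j$, there exist uncountably many totally irrational $\boldsymbol{\xi}\in S$ with $\hat{\omega}_{\boldsymbol{s}}(\boldsymbol{\xi}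)\ge\frac{1}{n(1-\delta)}$.
   Context: A subset of $\mathbb{R}$ is perfect if it is compact and has no isolated points. A set $S\subset\mathbb{R}^n$ is locally closed if $S=\overline{S}\cap\mathcal{W}$ for some open $\mathcal{W}\subset\mathbb{R}^n$. $\mathbb{R}_+$ denotes the positive reals. Write $\|\boldsymbol{x}\|=\max_j|x_j|$, $\boldsymbol{x}\cdot\boldsymbol{y}=\sum_jx_jy_j$; for $x\in\mathbb{R}$ let $\langle x\rangle$ be the distance from $x$ to the nearest integer, and $\langle\boldsymbol{x}\rangle=(\langle x_1\rangle,\ldots,\langle x_n\rangle)$. For a primitive vector $\mathbf{m}=(m_0,m_1,\ldots,m_n)\in\mathbb{Z}^{n+1}$ with $(m_1,\ldots,m_n)\neq 0$, put $A_{\mathbf{m}}=\{\boldsymbol{\xi}\in\mathbb{R}^n:\sum_{i=1}^n m_i\xi_i=m_0\}$ and $|A_{\mathbf{m}}|=\|(m_1,\ldots,m_n)\|$. The sets $A_{\mathbf{m}}$ are the rational affine hyperplanes. Khintchine system for $S$: disjoint (countable) collections $\{L_1,L_2,\ldots\}$ and $\{L'_1,L'_2,\ldots\}$ of distinct closed subsets of $S$ (closed in $S$), each contained in a rational affine hyperplane, together with, for each $i$, a rational affine hyperplane $A_i\supset L_i$, such that (closures taken in $S$): (a) $\bigcup_i L_i\cup\bigcup_j L'_j=\{\boldsymbol{x}\in S:\boldsymbol{x}\text{ is contained in a rational affine hyperplane}\}$; (b) for each $i$ and each $T>0$, $L_i=\overline{\bigcup_{j:\,|A_j|>T}(L_i\cap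 L_j)}$; (c) for each $i$ and any finite sets of indices $F,F'$ with $i\notin F$, $L_i=\overline{L_i\smallsetminus(\bigcup_{k\in F}L_k\cup\bigcup_{k'\in F'}L'_{k'})}$; (d) $\bigcup_i L_i$ is dense in $S$. A vector $\boldsymbol{\xi}\in\mathbb{R}^n$ is totally irrational if $1,\xi_1,\ldots,\xi_n$ are linearly independent over $\mathbb{Q}$. Define $\psi_{\Phi,\boldsymbol{\xi}}(t)=\min\{\langle\boldsymbol{q}\cdot\boldsymbol{\xi}\rangle:\boldsymbol{q}\in\mathbb{Z}^n\smallsetminus\{\boldsymbol{0}\},\ \Phi(\boldsymbol{q})\le t\}$ (for $t$ large enough that this set is nonempty). Exponents (all are suprema, possibly $\infty$): $\hat{\omega}(\boldsymbol{\xi})$ is the supremum of $\gamma>0$ such that for all large $t$ there is an integer $q$ with $0<q\le t$, $\|\langle q\boldsymbol{\xi}\rangle\|\le t^{-\gamma}$; $\hat{\omega}^*(\boldsymbol{\xi})$ is the supremum of $\gamma>0$ such that for all large $t$ there is $\boldsymbol{q}\in\mathbb{Z}^n$ with $0<\|\boldsymbol{q}\|\le t$, $\langle\boldsymbol{q}\cdot\boldsymbol{\xi}\rangle\le t^{-\gamma}$. With $\|\boldsymbol{x}\|_{\boldsymbol{s}}=\max_j|x_j|^{1/s_j}$: $\hat{\omega}_{\boldsymbol{s}}(\boldsymbol{\xi})$ is the supremum of $\gamma$ such that for all large $t$ there is an integer $q$ with $0<q\le t$, $\|\langle q\boldsymbol{\xi}\rangle\|_{\boldsymbol{s}}\le t^{-n\gamma}$;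 $\hat{\omega}^*_{\boldsymbol{s}}(\boldsymbol{\xi})$ is the supremum of $\gamma$ such that for all large $t$ there is $\boldsymbol{q}\in\mathbb{Z}^n$ with $0<\|\boldsymbol{q}\|_{\boldsymbol{s}}\le t^n$, $\langle\boldsymbol{q}\cdot\boldsymbol{\xi}\rangle\le t^{-\gamma}$. *)

(* Defs.v *)
From HB Require Import structures.
From mathcomp Require Import all_boot all_order all_algebra.
From mathcomp Require Import all_classical all_reals all_analysis.

Set Implicit Arguments.
Unset Strict Implicit.
Unset Printing Implicit Defensive.

Import Order.TTheory GRing.Theory Num.Theory.
Import numFieldNormedType.Exports.

Local Open Scope classical_set_scope.
Local Open Scope ring_scope.

(* Points of R^n are row vectors 'rV[R]_n; the norm `|x| of such an x is the
   sup norm, and the topology is the one induced by it. *)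

Definition perfect_subset (R : realType) (A : set R) : Prop :=
  compact A /\ isolated A = set0.

Definition rationals (R : realType) : set R := range (ratr : rat -> R).
Arguments rationals R _ : clear implicits.

Definition dense_in (T : topologicalType) (A B : set T) : Prop :=
  A `<=` B /\ B `<=` closure A.

Definition locally_closed (T : topologicalType) (S : set T) : Prop :=
  exists2 W, open W & S = closure S `&` W.

(* For A a subset of S: closedness and closure in the subspace topology of S. *)
Definition closed_in (T : topologicalType) (S A : set T) : Prop :=
  exists2 C, closed C & A = S `&` C.

Definition closure_in (T : topologicalType) (S A : set T) : set T :=
  closure A `&` S.

Definition cartesian (R : realType) n (Sf : 'I_n -> set R) : set 'rV[R]_n :=
  [set x | forall j, Sf j (x 0 j)].

Definition int_vec (R : realType) n (q : 'rV[int]_n) : 'rV[R]_n :=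
  map_mx (intr : int -> R) q.

Definition dotp (R : realType) n (x y : 'rV[R]_n) : R :=
  \sum_(j < n) x 0 j * y 0 j.

Definition primitive n (m : 'rV[int]_n) : bool :=
  (\big[gcdn/0]_(i < n) `|m 0%R i|)%N == 1%N.

(* The part (m_1, ..., m_n) of m = (m_0, m_1, ..., m_n). *)
Definition normal n (m : 'rV[int]_n.+1) : 'rV[int]_n :=
  \row_(j < n) m 0 (lift ord0 j).

(* A rational affine hyperplane is given by a primitive vector m defining it;
   m and -m define the same hyperplane and give the same height. *)
Record rat_hyperplane (n : nat) := RatHyperplane {
  hyp_vec :> 'rV[int]_n.+1;
  hyp_primitive : primitive hyp_vec;
  hyp_normal_neq0 : normal hyp_vec != 0
}.

Definition hyp_set (R : realType) n (A : rat_hyperplane n) : set 'rV[R]_n :=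
  [set xi | dotp (int_vec R (normal A)) xi = (A 0 ord0)%:~R].
Arguments hyp_set R {n} A.

Definition height (R : realType) n (A : rat_hyperplane n) : R :=
  `|int_vec R (normal A)|.

(* The countable collections are families indexed by countable types; their
   members are pairwise distinct, so the families are injective. *)
Record khintchine_system (R : realType) n (S : set 'rV[R]_n) (I J : countType)
    (L : I -> set 'rV[R]_n) (L' : J -> set 'rV[R]_n)
    (A : I -> rat_hyperplane n) : Prop := KhintchineSystem {
  kh_injL : injective L;
  kh_injL' : injective L';
  kh_disjoint : forall i j, L i <> L' j;
  kh_closedL : forall i, closed_in S (L i);
  kh_closedL' : forall j, closed_in S (L' j);
  kh_hypL : forall i, L i `<=` hyp_set R (A i);
  kh_hypL' : forall j, exists B : rat_hyperplane n, L' j `<=` hyp_set R B;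
  kh_union : (\bigcup_i L i) `|` (\bigcup_j L' j) =
    S `&` [set x | exists B : rat_hyperplane n, hyp_set R B x];
  kh_high : forall i (T : R), 0 < T ->
    L i = closure_in S (\bigcup_(j in [set j | T < height R (A j)])
                          (L i `&` L j));
  kh_avoid : forall i (F : set I) (F' : set J),
    finite_set F -> finite_set F' -> ~ F i ->
    L i = closure_in S
      (L i `\` ((\bigcup_(k in F) L k) `|` (\bigcup_(k in F') L' k)));
  kh_dense : dense_in (\bigcup_i L i) S
}.

Definition totally_irrational (R : realType) n (xi : 'rV[R]_n) : Prop :=
  forall (a : rat) (b : 'rV[rat]_n),
    ratr a + \sum_(j < n) ratr (b 0 j) * xi 0 j = 0 -> a = 0 /\ b = 0.

(* Distance to the nearest integer. *)
Definition dist_int (R : realType) (x : R) : R :=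
  inf (range (fun k : int => `|x - k%:~R|)).

Definition dist_int_vec (R : realType) n (x : 'rV[R]_n) : 'rV[R]_n :=
  map_mx (@dist_int R) x.

(* The infimum is a minimum as soon as {q <> 0 | Phi q <= t} is finite and
   nonempty. *)
Definition psi (R : realType) n (Phi : 'rV[int]_n -> R) (xi : 'rV[R]_n)
    (t : R) : R :=
  inf [set dist_int (dotp (int_vec R q) xi) |
       q in [set q | q != 0 /\ Phi q <= t]].

Definition wnorm (R : realType) n (s x : 'rV[R]_n) : R :=
  \big[Num.max/0]_(j < n) `|x 0 j| `^ (s 0 j)^-1.

Definition omega_hat (R : realType) n (xi : 'rV[R]_n) : \bar R :=
  ereal_sup [set g%:E | g in [set g : R | 0 < g /\
    \forall t \near +oo_R, exists q : int,
      0 < (q%:~R : R) <= t /\ `|dist_int_vec ((q%:~R : R) *: xi)| <= t `^ (- g)]].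

Definition omega_hat_dual (R : realType) n (xi : 'rV[R]_n) : \bar R :=
  ereal_sup [set g%:E | g in [set g : R | 0 < g /\
    \forall t \near +oo_R, exists q : 'rV[int]_n,
      0 < `|int_vec R q| <= t /\
      dist_int (dotp (int_vec R q) xi) <= t `^ (- g)]].

Definition omega_hat_w (R : realType) n (s xi : 'rV[R]_n) : \bar R :=
  ereal_sup [set g%:E | g in [set g : R |
    \forall t \near +oo_R, exists q : int,
      0 < (q%:~R : R) <= t /\
      wnorm s (dist_int_vec (q%:~R *: xi)) <= t `^ (- (n%:R * g))]].

Definition omega_hat_dual_w (R : realType) n (s xi : 'rV[R]_n) : \bar R :=
  ereal_sup [set g%:E | g in [set g : R |
    \forall t \near +oo_R, exists q : 'rV[int]_n,
      0 < wnorm s (int_vec R q) <= t ^+ n /\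
      dist_int (dotp (int_vec R q) xi) <= t `^ (- g)]].

Definition weight (R : realType) n (s : 'rV[R]_n) : Prop :=
  (forall j, 0 < s 0 j < 1) /\ \sum_(j < n) s 0 j = 1.

(* The default value 1 exceeds every coordinate of a weight. *)
Definition min_weight (R : realType) n (s : 'rV[R]_n) : R :=
  \big[Num.min/1]_(j < n) s 0 j.

Definition uncountably_many (T : Type) (P : T -> Prop) : Prop :=
  ~ countable [set x | P x].

(* Main.v *)
Require Import Defs.
From HB Require Import structures.
From mathcomp Require Import all_boot all_order all_algebra.
From mathcomp Require Import all_classical all_reals all_analysis.
From mathcomp Require Import ring lra zify.
Import Order.TTheory GRing.Theory Num.Theory.
Import numFieldNormedType.Exports.
Local Open Scope classical_set_scope.
Local Open Scope ring_scope.
Set Implicit Arguments.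
Unset Strict Implicit.
Unset Printing Implicit Defensive.

(** Call a slice a set S `&` {x_k = r}, where k is one of the first two
    coordinates and r is a rational point of S_k; it lies in the rational
    hyperplane {x_k = r}, whose height is the denominator of r. The slices form
    the family L of a Khintchine system ([product_khintchine_system]), the
    other sets S `&` B with B a rational hyperplane form the family L'. Two
    slices in different directions meet, and S_k has no isolated points, so
    that near any of its points there are rationals of S_k with denominators as
    large as wanted: this is the condition (b). For (c), a slice has no
    isolated points in any direction other than k, so a hyperplane B containing
    an open piece of it is the hyperplane {x_k = r} itself ([inessential_hyp]).

    A Khintchine system in a compact set yields points that are very close to
    hyperplanes of the system at all scales ([uncountably_many_approximable]).
    One builds a sequence of indices i_0, i_1, ... and nested closed
    neighbourhoods K_0, K_1, ... of points of L_(i_0), L_(i_1), ... Given K_j,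
    the condition (b) supplies a point of L_(i_j) inside K_j that also lies on
    some L_(i_(j+1)) of larger height; only after i_(j+1) is known,
    K_(j+1) is shrunk around that point until all of its points are as close to
    A_(i_j) as any prescribed function of i_(j+1) demands. A point of all the
    K_j is therefore close to A_(i_j) relative to the size of the next
    hyperplane, so that the normals of the A_(i_j) give small linear forms for
    every large t, not just for a sequence of values of t
    ([uncountably_many_singular]). Countably many nowhere dense sets can be
    avoided on the way: by (c) the sets L_k and L'_k, which makes the limit
    totally irrational, and the singletons of any countable set of points,
    which is why no countable set contains all the limits.

    The statement about a given Phi and phi is immediate from this. The other
    four follow from one property, [axis_singular], which is obtained with the
    exponential Phi(q) = exp(|q|) and phi(t) = exp(-t): for all large t there
    are a coordinate k and an integer 0 < d <= ln t such that d * xi_k is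
    within exp(-t) of an integer. The vector d * e_k shows at once that the
    dual exponents are infinite. For the simultaneous exponents the point is
    that the small linear form involves a single coordinate: applying
    Dirichlet's theorem to the numbers d * xi_j gives a multiple q = m * d <=
    t, which is good for all j <> k by Dirichlet and for k because m * exp(-t)
    is tiny. The pigeonholes are spent on the coordinates j <> k only, whose
    weights add up to 1 - s_k <= 1 - delta; this is where the value 1 / (n (1 -
    delta)) comes from ([axis_singular_simultaneous]). The exponent without
    weights is the case s = (1/n, ..., 1/n), delta = 1/n. *)

(** * Countability and topology *)

Lemma countableU (T : Type) (A B : set T) :
  countable A -> countable B -> countable (A `|` B).
Proof.
move=> cA cB; rewrite -bigcup2E.
by apply: bigcup_countable => // -[|[|m]] _ //=; exact: countable0.
Qed.

Lemma countable_sub_range (T : Type) (x0 : T) (A : set T) :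
  countable A -> exists u : nat -> T, A `<=` range u.
Proof.
move=> /countable_injP[f finj].
have /choice[u uP] m : exists t, forall a, A a -> f a = m -> t = a.
  have [[a [Aa fa]]|noa] := pselect (exists a, A a /\ f a = m).
    by exists a => b Ab fb; apply: finj; rewrite ?inE// fa.
  by exists x0 => a Aa fa; case: noa; exists a.
by exists u => a Aa; exists (f a) => //; exact: uP.
Qed.

(** Members of a countable set of sets can be listed without repetition by a
    countable type. It serves for the sets cut out by hyperplanes, where many
    hyperplanes may cut out the same set. *)
Lemma countable_enumeration (T : Type) (F : set T) :
  countable F -> exists (J : countType) (f : J -> T), injective f /\ range f = F.
Proof.
move=> /countable_injP[g ginj].
pose J := {m : nat | `[< exists2 a, F a & g a = m >]}.
have JP (m : J) : exists2 a, F a & g a = val m by apply/asboolP; exact: valP m.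
pose f m := s2val (cid2 (JP m)).
have Ff m : F (f m) by rewrite /f; case: cid2.
have gf m : g (f m) = val m by rewrite /f; case: cid2.
exists J, f; split; first by move=> m k fmk; apply: val_inj; rewrite /= -!gf fmk.
apply/seteqP; split=> [_ [m _ <-]//|a Fa].
have aJ : `[< exists2 b, F b & g b = g a >] by apply/asboolP; exists a.
exists (exist _ (g a) aJ) => //; apply: ginj; rewrite ?inE//; exact: gf.
Qed.

Lemma uncountably_manyS (T : Type) (P Q : T -> Prop) :
  (forall x, P x -> Q x) -> uncountably_many P -> uncountably_many Q.
Proof.
by move=> PQ uP cQ; apply: uP; apply: sub_countable cQ; apply: subset_card_le.
Qed.

(** Any cluster point of a sequence of points of the sets S `&` K j works: each
    closed K j contains a tail of the sequence. *)
Lemma compact_nested (T : topologicalType) (S : set T) (K : nat -> set T) :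
    compact S -> (forall j, closed (K j)) -> (forall j, K j.+1 `<=` K j) ->
    (forall j, S `&` K j !=set0) ->
  exists2 x, S x & forall j, K j x.
Proof.
move=> cS cK Kdec Kne.
have Kmono j m : (j <= m)%N -> K m `<=` K j.
  move=> /subnK <-; elim: (m - j)%N => // d IH.
  by rewrite addSn; exact: subset_trans (Kdec _) IH.
have [c cSK] := choice Kne.
have [x [Sx]] : S `&` cluster (c @ \oo) !=set0.
  by apply: cS; exists 0%N => // m _; have [] := cSK m.
rewrite clusterE => clx; exists x => // j.
rewrite ((closure_id (K j)).1 (cK j)); apply: clx; exists j => // m /= jm.
by apply: (Kmono _ _ jm); have [] := cSK m.
Qed.

(** Every neighbourhood of a point of A contains infinitely many points of A;
    one of them is outside the finite set G, and E is dense near it. *)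
Lemma perfect_closureD (T : topologicalType) (A E G : set T) :
    accessible_space T -> isolated A = set0 -> dense_in E A -> finite_set G ->
  A `<=` closure (E `\` G).
Proof.
move=> accT A0 [EA AE] Gfin x Ax V xV.
have clG := accessible_finite_set_closed.1 accT.
have openGC : open (~` G) by apply: closed_openC; exact: clG Gfin.
pose W := V° `&` ~` (G `\ x).
(* Removing G except x keeps a neighbourhood of x, and x is not isolated. *)
have xW : nbhs x W.
  apply: filterI; first exact: nbhs_interior.
  apply: open_nbhs_nbhs; split; last by case=> _; apply.
  by apply: closed_openC; apply: clG; exact: finite_setD.
have [a [Aa Va Ga]] : exists a, [/\ A a, V° a & ~ G a].
  apply: contrapT => /forallNP na; suff : isolated A x by rewrite A0.
  split; [exact/mem_set|exists W => //].
  apply/seteqP; split => [a [[Va Ga] Aa]|_ ->]; last first.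
    by split => //; exact: nbhs_singleton.
  by apply: contrapT => ax; apply: (na a); split => // Ga'; apply: Ga.
have [e [Ee [Ve Ge]]] : E `&` (V `&` ~` G) !=set0.
  apply: (AE _ Aa); apply: filterI; first exact: Va.
  exact: open_nbhs_nbhs.
by exists e.
Qed.

(** The usual argument for the intersection of two dense sets one of which is
    open, read in the subspace D. *)
Lemma closureD_setU (T : topologicalType) (D U V : set T) : closed U ->
  D `<=` closure (D `\` U) -> D `<=` closure (D `\` V) ->
  D `<=` closure (D `\` (U `|` V)).
Proof.
move=> cU DU DV x Dx W xW.
have [y [[Dy nUy] Wy]] := DU _ Dx _ (nbhs_interior xW).
have [|z [[Dz nVz] [Wz nUz]]] := DV _ Dy (W `&` ~` U).
  apply: filterI; first exact: Wy.
  by apply: open_nbhs_nbhs; split => //; exact: closed_openC.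
by exists z; split => //; split => // -[].
Qed.

Lemma closureD_bigcup (T : topologicalType) (I : choiceType) (D : set T)
    (F : set I) (C : I -> set T) : finite_set F ->
    (forall i, F i -> closed (C i) /\ D `<=` closure (D `\` C i)) ->
  D `<=` closure (D `\` \bigcup_(i in F) C i).
Proof.
move=> /finite_seqP[s ->]; rewrite bigcup_seq.
elim: s => [|i s IH] FC; first by rewrite big_nil setD0; exact: subset_closure.
rewrite big_cons; have [|cCi Di] := FC i; first by rewrite /= mem_head.
by apply: closureD_setU => //; apply: IH => j /= js; apply: FC; rewrite /= inE js orbT.
Qed.

(** * Distance to the integers and linear forms *)

Lemma dist_int_ge0 (R : realType) (x : R) : 0 <= dist_int x.
Proof. by apply: lb_le_inf => [|_ [k _ <-]//]; exists `|x - 0%:~R|, 0. Qed.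

Lemma dist_int_le (R : realType) (x : R) (k : int) : dist_int x <= `|x - k%:~R|.
Proof. by apply: ge_inf; [exists 0 => _ [j _ <-]|exists k]. Qed.

Lemma dist_int_natmul (R : realType) (m : nat) (x : R) :
  dist_int (m%:R * x) <= m%:R * dist_int x.
Proof.
case: m => [|m].
  by rewrite !mul0r; apply: le_trans (dist_int_le _ 0) _; rewrite subr0 normr0.
have m0 : 0 < m.+1%:R :> R by [].
rewrite -ler_pdivrMl//; apply: lb_le_inf => [|_ [k _ <-]].
  by exists `|x - 0%:~R|, 0.
rewrite ler_pdivrMl//; apply: le_trans (dist_int_le _ (m.+1%:Z * k)) _.
by rewrite intrM -mulrBr normrM gtr0_norm.
Qed.

Lemma rV_entry_le_norm (R : realType) n (x : 'rV[R]_n) j : `|x 0 j| <= `|x|.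
Proof.
rewrite [leRHS]/Num.norm /= mx_normrE.
exact: (le_bigmax _ (fun ij => `|x ij.1 ij.2|) (0, j)).
Qed.

Lemma rV_norm_le (R : realType) n (x : 'rV[R]_n) (e : R) :
  0 <= e -> (forall j, `|x 0 j| <= e) -> `|x| <= e.
Proof.
move=> e0 xe; rewrite [leLHS]/Num.norm /= mx_normrE.
by apply: bigmax_le => // -[i j] _; rewrite ord1; exact: xe.
Qed.

Lemma dotp_continuous (R : realType) n (a : 'rV[R]_n) : continuous (dotp a).
Proof.
apply: (@continuous_big _ _ _ _ _ (@add_continuous R) _ _
  (fun j (x : 'rV[R]_n) => a 0 j * x 0 j)) => j _ x.
by apply: continuousM; [exact: cst_continuous|exact: coord_continuous].
Qed.

Lemma closed_hyp_set (R : realType) n (B : rat_hyperplane n) :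
  closed (hyp_set R B).
Proof.
rewrite (_ : hyp_set R B =
  dotp (int_vec R (normal B)) @^-1` [set (B 0 ord0)%:~R])//.
by apply: preimage_closed; [move=> x _; exact: dotp_continuous|exact: closed_eq].
Qed.

(** * Total irrationality and rational hyperplanes *)

(** The defining vector is made primitive by dividing it by the gcd of its
    entries. *)
Lemma rat_hyperplane_of_vec n (m : 'rV[int]_n.+1) : normal m != 0 ->
  exists B : rat_hyperplane n, forall R : realType,
    hyp_set R B = [set xi | dotp (int_vec R (normal m)) xi = (m 0 ord0)%:~R].
Proof.
move=> m0; pose g := \big[gcdn/0%N]_(i < n.+1) absz (m 0%R i).
have gdvd i : (g %| absz (m 0%R i))%N by exact: (biggcdn_inf i).
have g0 : (0 < g)%N.
  rewrite lt0n; apply: contraNneq m0 => g0; apply/eqP/rowP => j; rewrite !mxE.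
  by apply/eqP; have := gdvd (lift ord0 j); rewrite g0 dvd0n absz_eq0.
pose v := \row_(i < n.+1) (m 0%R i %/ g%:Z)%Z.
have mv : m = g%:Z *: v.
  by apply/rowP => i; rewrite !mxE mulrC divzK// dvdzE.
have prim : primitive v.
  rewrite /primitive; set d := (X in X == _).
  (* If d divides all the m_i / g, then g * d divides the gcd g. *)
  have : (g * d %| g)%N.
    apply/dvdn_biggcdP => i _; rewrite {1}mv mxE abszM absz_nat dvdn_pmul2l//.
    exact: (biggcdn_inf i).
  by rewrite -{2}(muln1 g) dvdn_pmul2l// dvdn1.
have nmv : normal m = g%:Z *: normal v by apply/rowP => j; rewrite {1}mv !mxE.
have v0 : normal v != 0.
  by apply: contraNneq m0 => v0; rewrite nmv v0 scaler0.
exists (RatHyperplane prim v0) => R.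
have gR : g%:Z%:~R != 0 :> R by rewrite intr_eq0 eqz_nat -lt0n.
apply/seteqP; split=> xi; rewrite /hyp_set /= /dotp => vxi.
all: have E : \sum_(j < n) int_vec R (normal m) 0 j * xi 0 j =
              g%:Z%:~R * \sum_(j < n) int_vec R (normal v) 0 j * xi 0 j
       by rewrite mulr_sumr; apply: eq_bigr => j _;
          rewrite nmv !mxE intrM mulrA.
- by rewrite E vxi [in RHS]mv !mxE intrM.
- by apply: (mulfI gR); rewrite -E vxi {1}mv !mxE intrM.
Qed.

Lemma rat_mul_denq (c : rat) (k : int) :
  exists z : int, c * (denq c * k)%:~R = z%:~R.
Proof.
exists (numq c * k); rewrite !intrM mulrA -{1}(divq_num_den c) divfK//.
by rewrite intr_eq0 denq_neq0.
Qed.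

(** After clearing denominators, a rational dependence between 1 and the xi_j
    with b <> 0 is the equation of a rational hyperplane through xi. *)
Lemma totally_irrational_hyp (R : realType) n (xi : 'rV[R]_n) :
  (forall B : rat_hyperplane n, ~ hyp_set R B xi) -> totally_irrational xi.
Proof.
move=> nB a b ab; have [b0|b0] := eqVneq b 0.
  split => //; apply/eqP; rewrite -(fmorph_eq0 (@ratr R)); apply/eqP.
  by rewrite -[RHS]ab b0 big1 ?addr0// => j _; rewrite mxE rmorph0 mul0r.
exfalso; pose D := denq a * \prod_(j < n) denq (b 0 j).
have [z0 z0E] := rat_mul_denq a (\prod_(j < n) denq (b 0 j)).
have /choice[z zE] j : exists z : int, b 0 j * D%:~R = z%:~R.
  rewrite /D (bigD1 j)//= mulrCA; exact: rat_mul_denq.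
have D0 : (D%:~R : rat) != 0.
  by rewrite intr_eq0 mulf_neq0 ?denq_neq0//; apply/prodf_neq0 => j _.
pose m := \row_(i < n.+1) oapp z (- z0) (unlift ord0 i).
have nm j : normal m 0 j = z j by rewrite !mxE liftK.
have m0 : normal m != 0.
  apply: contraNneq b0 => m0; apply/eqP/rowP => j; rewrite mxE.
  by apply: (mulIf D0); rewrite mul0r zE -nm m0 mxE.
have [B HB] := rat_hyperplane_of_vec m0.
apply: (nB B); rewrite HB /= /dotp mxE unlift_none /= intrN.
have zR (c : rat) (y : int) : c * D%:~R = y%:~R -> y%:~R = ratr c * D%:~R :> R.
  by move=> cy; rewrite -(ratr_int R y) -cy rmorphM /= ratr_int.
rewrite (zR _ _ z0E); apply/eqP; rewrite -addr_eq0; apply/eqP.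
transitivity ((ratr a + \sum_(j < n) ratr (b 0 j) * xi 0 j) * D%:~R).
  rewrite mulrDl addrC mulr_suml; congr (_ + _); apply: eq_bigr => j _.
  by rewrite mxE nm (zR _ _ (zE j)); ring.
by rewrite ab mul0r.
Qed.

(** * Very well approximable points of Khintchine systems *)

Section KhintchineSystems.
Variables (R : realType) (n : nat) (S : set 'rV[R]_n) (I J : countType).
Variables (L : I -> set 'rV[R]_n) (L' : J -> set 'rV[R]_n).
Variable (A : I -> rat_hyperplane n).
Hypothesis khS : khintchine_system S L L' A.
Hypothesis closedS : closed S.

Local Notation normalA i := (int_vec R (normal (A i))).

(** For closed C this says that C is nowhere dense in L i. *)
Definition inessential (i : I) (C : set 'rV[R]_n) : Prop :=
  L i `<=` closure (L i `\` C).

Lemma khL_closed i : closed (L i).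
Proof. by have [C cC ->] := kh_closedL khS i; exact: closedI. Qed.

Lemma khL'_closed j : closed (L' j).
Proof. by have [C cC ->] := kh_closedL' khS j; exact: closedI. Qed.

Lemma khL_subset i : L i `<=` S.
Proof. by have [C _ ->] := kh_closedL khS i; exact: subIsetl. Qed.

Lemma inessential_L i k : k <> i -> inessential i (L k).
Proof.
move=> ki x Lx; have := Lx.
rewrite {1}(kh_avoid khS (finite_set1 k) (finite_set0 J)) => [|/esym//].
rewrite bigcup_set1 bigcup_set0 setU0.
by case.
Qed.

Lemma inessential_L' i j : inessential i (L' j).
Proof.
move=> x Lx; have := Lx.
rewrite {1}(kh_avoid khS (finite_set0 I) (finite_set1 j)) => [|//].
by rewrite bigcup_set1 bigcup_set0 set0U; case.
Qed.

Lemma kh_high_near i (T : R) x (V : set 'rV[R]_n) : L i x -> nbhs x V ->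
  exists j y, [/\ T < height R (A j), L i y, L j y & V y].
Proof.
move=> Lx xV; have T1 : 0 < Num.max T 1 by rewrite lt_max ltr01 orbT.
have := Lx; rewrite {1}(kh_high khS i T1).
case=> /(_ _ xV)[y [[j /= Tj [Liy Ljy]] Vy]] _.
by exists j, y; split => //; apply: le_lt_trans Tj; rewrite le_max lexx.
Qed.

(** L i has no isolated points: by (b), the point z could be isolated in L i
    only if it belonged to some other L j, and by (c) the set L i `\` L j
    accumulates at z. *)
Lemma inessential_point i z : inessential i [set z].
Proof.
move=> x Lx V xV.
have [xz|xz] := pselect (x = z); last first.
  by exists x; split; [split|exact: nbhs_singleton].
have [j [y [hj Liy Ljy Vy]]] := kh_high_near (height R (A i)) Lx xV.
have [yz|yz] := pselect (y = z); last by exists y.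
have ji : j <> i by move=> ji; rewrite ji ltxx in hj.
have [w [[Liw nLjw] Vw]] := inessential_L ji Lx xV.
by exists w; split => //; split => // wz; apply: nLjw; rewrite wz -yz.
Qed.

(** A step of the nested construction: the closed set surrounds a point of the
    current L i. *)
Record khintchine_stage := KhintchineStage {
  stage_index : I;
  stage_set : set 'rV[R]_n;
  stage_closed : closed stage_set;
  stage_inhab : exists2 c, L stage_index c & nbhs c stage_set }.

(** The bound f is evaluated at the new index j, but the linear form that it
    controls is the one of the old index i; this shift by one is what makes the
    approximation uniform in t. *)
Definition next_stage (f : I -> R) (C : set 'rV[R]_n) (s t : khintchine_stage) :=
  let i := stage_index s in let j := stage_index t in
  [/\ height R (A i) + 1 < height R (A j),
      stage_set t `<=` stage_set s,
      forall x, stage_set t x ->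
        `|dotp (normalA i) x - (A i 0 ord0)%:~R| < f j &
      closed C -> inessential i C -> stage_set t `&` C = set0].

(** First move inside L i off C, then inside L i to a point that also lies on
    some L j of large height, and shrink around it. The linear form of A i
    vanishes at that point, so it is as small as desired nearby, with j already
    known. *)
Lemma next_stage_exists (f : I -> R) C s :
  (forall i, 0 < f i) -> exists t, next_stage f C s t.
Proof.
move=> f0; case: s => i K cK [c Lc cV].
(* When C is not nowhere dense in L i, it is not avoided at this stage. *)
have [V [c1 [Lc1 c1V VK VC]]] : exists V c1, [/\ L i c1, nbhs c1 V, V `<=` K &
    closed C -> inessential i C -> V `&` C = set0].
  have [[cC iC]|nC] := pselect (closed C /\ inessential i C); last first.
    by exists K, c; split => // cC iC; case: nC.
  have [c1 [[Lc1 nCc1] Kc1]] := iC _ Lc _ (nbhs_interior cV).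
  exists (K `&` ~` C), c1; split=> [//||x []//|_ _].
    apply: filterI => //; apply: open_nbhs_nbhs.
    by split => //; exact: closed_openC.
  by rewrite -setIA setICl setI0.
have [j [c2 [hj Lic2 Ljc2 Vc2]]] :=
  kh_high_near (height R (A i) + 1) Lc1 (nbhs_interior c1V).
pose D := V `&` [set x | `|dotp (normalA i) x - (A i 0 ord0)%:~R| < f j].
have c2D : nbhs c2 D.
  apply: filterI => //.
  have := kh_hypL khS Lic2; rewrite /hyp_set /= => <-.
  by have /cvgrPdistC_lt/(_ _ (f0 j)) := @dotp_continuous _ _ (normalA i) c2.
have [W c2W WD] := uniform_regular c2D.
have inh : exists2 c, L j c & nbhs c (closure W).
  by exists c2 => //; apply: filterS c2W; exact: subset_closure.
exists (KhintchineStage (@closed_closure _ W) inh); split => //=.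
- by apply: subset_trans WD _; apply: subset_trans (@subIsetl _ _ _) VK.
- by move=> x /WD[].
- move=> cC iC; rewrite -subset0 => x [/WD[Vx _] Cx].
  by rewrite -(VC cC iC).
Qed.

Lemma stage_sequence (f : I -> R) (C : nat -> set 'rV[R]_n) :
    compact S -> S !=set0 -> (forall i, 0 < f i) ->
  exists x (i : nat -> I), [/\ S x,
    forall j, height R (A (i j)) + 1 < height R (A (i j.+1)),
    forall j, `|dotp (normalA (i j)) x - (A (i j) 0 ord0)%:~R| < f (i j.+1) &
    forall j, closed (C j) -> inessential (i j) (C j) -> ~ C j x].
Proof.
move=> compactS [x0 Sx0] f0.
have [c [[i0 _ Lc] _]] := (kh_dense khS).2 _ Sx0 _ (@filterT _ _ (nbhs_filter x0)).
have inh0 : exists2 c, L i0 c & nbhs c setT by exists c => //; exact: filterT.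
pose next (p q : nat * khintchine_stage) :=
  q.1 = p.1.+1 /\ next_stage f (C p.1) p.2 q.2.
have nextP p : {q | next p q}.
  by apply: cid; have [t pt] := next_stage_exists (C p.1) p.2 f0; exists (p.1.+1, t).
have [s [s0 snext]] := dependent_choice nextP (0%N, KhintchineStage closedT inh0).
have s1 j : (s j).1 = j.
  by elim: j => [|j IH]; [rewrite s0|have [-> _] := snext j; rewrite IH].
pose K j := stage_set (s j).2.
have Kdec j : K j.+1 `<=` K j by have [_ []] := snext j.
have Kne j : S `&` K j !=set0.
  have [d Ld dK] := stage_inhab (s j).2.
  by exists d; split; [exact: khL_subset Ld|exact: nbhs_singleton dK].
have [x Sx Kx] := compact_nested compactS (fun j => @stage_closed (s j).2) Kdec Kne.
exists x, (fun j => stage_index (s j).2); split=> // j.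
- by have [_ []] := snext j.
- by have [_ [_ _ + _]] := snext j; apply; exact: Kx.
- move=> cC iC Cx; have [_ [_ _ _]] := snext j; rewrite s1 => /(_ cC iC) KC.
  by suff : set0 x by []; rewrite -KC; split => //; exact: Kx.
Qed.

(** If the set of these points were countable, then its singletons could be
    added to the countable list of sets to avoid, and the construction would
    produce a point of the set outside the set. Since L k is inessential in
    every L i but itself, it is enough to process each set of the list at two
    successive stages, whose indices differ as the heights do. *)
Lemma uncountably_many_approximable (f : I -> R) :
    compact S -> S !=set0 -> (forall i, 0 < f i) ->
  uncountably_many (fun xi => [/\ S xi,
    forall B : rat_hyperplane n, ~ hyp_set R B xi &
    exists i : nat -> I,
      (forall j, height R (A (i j)) + 1 < height R (A (i j.+1))) /\
      forall j, `|dotp (normalA (i j)) xi - (A (i j) 0 ord0)%:~R| < f (i j.+1)]).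
Proof.
move=> compactS S0 f0.
rewrite /uncountably_many /=; set G := (X in ~ countable X) => countG.
have [u uP] : exists u : nat -> set 'rV[R]_n,
    (range L `|` range L') `|` set1 @` G `<=` range u.
  apply: (countable_sub_range set0).
  by apply: countableU; [apply: countableU|];
    apply: sub_countable (card_image_le _ _) _.
(* Stages 2m and 2m+1 both process u m. *)
have [x [i [Sx hi fi ux]]] := @stage_sequence f (fun j => u j./2) compactS S0 f0.
have iS j : i j <> i j.+1.
  by move=> ij; have := hi j; rewrite ij gtrDl ltr10.
have avoid C : closed C -> range u C ->
    (forall j, inessential (i j) C \/ inessential (i j.+1) C) -> ~ C x.
  move=> cC [m _ um] ess; have := ux m.*2; have := ux m.*2.+1.
  rewrite /= uphalf_double doubleK um => u1 u0.
  by case: (ess m.*2) => ie; [exact: u0|exact: u1].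
have xL k : ~ L k x.
  apply: avoid => [|//|j]; first exact: khL_closed.
    by apply: uP; left; left; exists k.
  have [ki|ki] := pselect (k = i j).
    by right; apply: inessential_L; rewrite ki.
  by left; exact: inessential_L.
have xL' k : ~ L' k x.
  apply: avoid => [|//|j]; first exact: khL'_closed.
    by apply: uP; left; right; exists k.
  by left; exact: inessential_L'.
have Gx : G x.
  split => // [B Bx|]; last by exists i.
  have : (S `&` [set x | exists B : rat_hyperplane n, hyp_set R B x]) x.
    by split => //; exists B.
  by rewrite -(kh_union khS) => -[[k _ Lk]|[k _ Lk]]; [exact: xL Lk|exact: xL' Lk].
apply: (@avoid [set x]) => //.
- exact/accessible_closed_set1/hausdorff_accessible/norm_hausdorff.
- by apply: uP; right; exists x.
- by move=> j; left; exact: inessential_point.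
Qed.

End KhintchineSystems.

Lemma exists_crossing (R : realType) (h : nat -> R) (t : R) m :
  h 0%N <= t -> t < h m -> exists j, h j <= t < h j.+1.
Proof.
move=> h0 hm; have [[|j] tj jmin] := ex_minnP (ex_intro (fun m => t < h m) m hm).
  by rewrite ltNge h0 in tj.
by exists j; rewrite tj leNgt andbT; apply/negP => /jmin; rewrite ltnn.
Qed.

(** The normals of the successive A (i j) are distinct, so their Phi-values are
    unbounded and t lies between two consecutive ones. The linear form of the
    first normal is bounded by phi at the second of these values, which is at
    most phi t. *)
Lemma uncountably_many_singular (R : realType) n (S : set 'rV[R]_n)
    (I J : countType) (L : I -> set 'rV[R]_n) (L' : J -> set 'rV[R]_n)
    (A : I -> rat_hyperplane n) (Phi : 'rV[int]_n -> R) (phi : R -> R) :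
    khintchine_system S L L' A -> compact S -> S !=set0 ->
    (forall q, q != 0 -> 0 < Phi q) ->
    (forall C : R, 0 < C -> finite_set [set q | q != 0 /\ Phi q <= C]) ->
    (forall t, 0 < t -> 0 < phi t) ->
    (forall t u, 0 < t -> t <= u -> phi u <= phi t) ->
  uncountably_many (fun xi => [/\ S xi, totally_irrational xi &
    \forall t \near +oo_R, exists i,
      Phi (normal (A i)) <= t /\
      dist_int (dotp (int_vec R (normal (A i))) xi) <= phi t]).
Proof.
move=> khS compactS S0 Phi0 Phifin phi0 phimono.
have closedS : closed S by apply: compact_closed => //; exact: norm_hausdorff.
have A0 i : 0 < Phi (normal (A i)) by apply: Phi0; exact: hyp_normal_neq0.
have := uncountably_many_approximable khS closedS compactS S0
  (fun i => phi0 _ (A0 i)).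
apply: uncountably_manyS => xi [Sxi nB [i [hi xii]]].
split=> //; first exact: totally_irrational_hyp.
have hmono : {homo (fun j => height R (A (i j))) : j k / (j < k)%N >-> j < k}.
  by apply: homo_ltn lt_trans _ => j; apply: lt_trans (hi j); rewrite ltrDl.
pose h j := Phi (normal (A (i j))).
exists (h 0%N); split => [|t h0t]; first exact: num_real.
have t0 : 0 < t by apply: lt_trans h0t; exact: A0.
have [m tm] : exists m, t < h m.
  apply: contrapT => /forallNP bnd.
  have inj : {in setT &, injective (fun j => normal (A (i j)))}.
    move=> j k _ _ jk; apply: contrapT => /eqP; rewrite neq_ltn.
    by case/orP=> /hmono; rewrite /height jk ltxx.
  have := infinite_nat; apply; rewrite -(eq_finite_set (inj_card_eq inj)).
  apply: sub_finite_set (Phifin _ t0) => _ [j _ <-].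
  by split; [exact: hyp_normal_neq0|rewrite leNgt; apply/negP/bnd].
have [j /andP[hjt thj]] := exists_crossing (ltW h0t) tm.
exists (i j); split => //; apply: le_trans (dist_int_le _ _) _.
by apply: le_trans (ltW (xii j)) _; apply: phimono => //; exact: ltW.
Qed.

(** * Changing one coordinate *)

Definition replace (R : realType) n (x : 'rV[R]_n) (k : 'I_n) (y : R) :
    'rV[R]_n :=
  \row_j (if j == k then y else x 0 j).

Lemma replace_id (R : realType) n (x : 'rV[R]_n) k : replace x k (x 0 k) = x.
Proof. by apply/rowP => j; rewrite mxE; case: eqP => // ->. Qed.

Lemma replaceE (R : realType) n (x : 'rV[R]_n) k y : replace x k y 0 k = y.
Proof. by rewrite mxE eqxx. Qed.

Lemma replace_neq (R : realType) n (x : 'rV[R]_n) k j y :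
  j != k -> replace x k y 0 j = x 0 j.
Proof. by rewrite mxE => /negPf->. Qed.

Lemma dotp_replace (R : realType) n (a x : 'rV[R]_n) k y :
  dotp a (replace x k y) = dotp a x + a 0 k * (y - x 0 k).
Proof.
rewrite /dotp !(bigD1 k (P := xpredT))//= replaceE.
rewrite (eq_bigr (fun j => a 0 j * x 0 j)); first by ring.
by move=> j jk; rewrite replace_neq.
Qed.

Lemma replace_continuous (R : realType) n (x : 'rV[R]_n) k :
  continuous (replace x k).
Proof.
move=> y V /nbhs_ballP[e e0 eV]; apply/nbhs_ballP; exists e => // z yz.
apply: eV; split=> // i j; rewrite !mxE; case: eqP => // _; exact: ballxx.
Qed.

(** The density statements in the product reduce to density on one axis. *)
Lemma closure_replace (R : realType) n (A : set 'rV[R]_n) (T : set R)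
    (x : 'rV[R]_n) k :
  closure T (x 0 k) -> (forall y, T y -> A (replace x k y)) -> closure A x.
Proof.
move=> clT TA V xV; have [|y [Ty Vy]] := clT (replace x k @^-1` V).
  by apply: (@replace_continuous _ _ x k); rewrite replace_id.
by exists (replace x k y); split => //; exact: TA.
Qed.

(** * Rationals of large denominator *)

Lemma finite_set_int_le (N : nat) : finite_set [set z : int | (absz z <= N)%N].
Proof.
apply: (@sub_finite_set _ _ ((Posz @` `I_N.+1) `|` ((fun m => - Posz m) @` `I_N.+1))).
  by case=> m /= mN; [left; exists m|right; exists m.+1; rewrite ?NegzE].
by rewrite finite_setU; split; apply: finite_image; exact: finite_II.
Qed.

Lemma finite_set_rat_bounded (R : realType) (x T : R) :
  finite_set [set p : rat | `|ratr p - x| < 1 /\ (denq p)%:~R <= T].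
Proof.
pose N := Num.trunc ((`|x| + 1) * T); pose M := Num.trunc T.
apply: (@sub_finite_set _ _ ((fun q => q.1%:Q / q.2%:Q) @`
  ([set z : int | (absz z <= N)%N] `*` [set z : int | (absz z <= M)%N]))); last first.
  by apply/finite_image/finite_setX; exact: finite_set_int_le.
move=> p /= [px pT]; exists (numq p, denq p); last by rewrite /= divq_num_den.
have d0 : 0 < (denq p)%:~R :> R by rewrite ltr0z denq_gt0.
have absR (z : int) : (absz z)%:R = `|z%:~R| :> R by rewrite natr_absz intr_norm.
have trunc_ge (m : nat) (y : R) : m%:R <= y -> (m <= Num.trunc y)%N.
  by move=> my; rewrite truncn_ge_nat// (le_trans _ my).
split; apply: trunc_ge; rewrite absR; last by rewrite gtr0_norm.
have -> : (numq p)%:~R = ratr p * (denq p)%:~R :> R.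
  by rewrite /ratr divfK// gt_eqF.
rewrite normrM (gtr0_norm d0); apply: ler_pM => //; first exact: ltW.
rewrite -lerBlDl; apply: le_trans (ltW px); exact: lerB_dist.
Qed.

(** Bounded sets contain finitely many rationals with denominators at most T,
    and removing finitely many points does not affect density in a set without
    isolated points. *)
Lemma dense_high_rationals (R : realType) (A : set R) (T : R) :
    isolated A = set0 -> dense_in (rationals R `&` A) A ->
  A `<=` closure [set y | A y /\ exists2 p : rat, y = ratr p & T < (denq p)%:~R].
Proof.
move=> A0 dA x Ax V xV.
have acc : accessible_space R by apply: hausdorff_accessible; exact: Rhausdorff.
have finG := finite_image (@ratr R) (finite_set_rat_bounded x T).
have [|y [[[[p _ py] Ay] yG] [Vy xy]]] := perfect_closureD acc A0 dA finG Ax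
  (B := V `&` ball x 1).
  by apply: filterI => //; exact: nbhsx_ballx.
exists y; split => //; split => //; exists p => //.
rewrite ltNge; apply/negP => pT; apply: yG; exists p => //; split => //.
by rewrite py distrC.
Qed.

(** * Hyperplanes orthogonal to a coordinate axis *)

(** The vector (r_num, 0, ..., r_den, ..., 0) of the hyperplane {x_k = r}. *)
Definition axis_vec n (k : 'I_n) (r : rat) : 'rV[int]_n.+1 :=
  \row_i oapp (fun j => if j == k then denq r else 0) (numq r) (unlift ord0 i).

Lemma normal_axis n (k : 'I_n) r j :
  normal (axis_vec k r) 0 j = if j == k then denq r else 0.
Proof. by rewrite !mxE liftK. Qed.

Lemma axis_vec_primitive n (k : 'I_n) r : primitive (axis_vec k r).
Proof.
rewrite /primitive -dvdn1; have := coprime_num_den r; rewrite /coprime => /eqP g1.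
rewrite -[X in (_ %| X)%N]g1 dvdn_gcd.
rewrite (biggcdn_inf ord0) ?mxE ?unlift_none//=.
by rewrite (biggcdn_inf (lift ord0 k))// mxE liftK /= eqxx.
Qed.

Lemma normal_axis_neq0 n (k : 'I_n) r : normal (axis_vec k r) != 0.
Proof.
apply/eqP => /rowP/(_ k)/eqP; rewrite normal_axis eqxx mxE.
by rewrite (negPf (denq_neq0 r)).
Qed.

Definition axis_hyperplane n (k : 'I_n) (r : rat) :=
  RatHyperplane (axis_vec_primitive k r) (normal_axis_neq0 k r).

Lemma dotp_axis (R : realType) n (k : 'I_n) r (x : 'rV[R]_n) :
  dotp (int_vec R (normal (axis_vec k r))) x = (denq r)%:~R * x 0 k.
Proof.
rewrite /dotp (bigD1 k)//= big1 ?addr0 => [|j jk]; rewrite mxE normal_axis.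
  by rewrite eqxx.
by rewrite (negPf jk) mul0r.
Qed.

Lemma hyp_set_axis (R : realType) n (k : 'I_n) r :
  hyp_set R (axis_hyperplane k r) = [set x | x 0 k = ratr r].
Proof.
have d0 : (denq r)%:~R != 0 :> R by rewrite intr_eq0 denq_neq0.
apply/seteqP; split=> x; rewrite /hyp_set /= dotp_axis mxE unlift_none /= => xr.
  by apply: (mulfI d0); rewrite xr /ratr mulrC divfK.
by rewrite xr /ratr mulrC divfK.
Qed.

Lemma height_axis (R : realType) n (k : 'I_n) r :
  (denq r)%:~R <= height R (axis_hyperplane k r).
Proof.
have := rV_entry_le_norm (int_vec R (normal (axis_vec k r))) k.
by rewrite mxE normal_axis eqxx gtr0_norm// ltr0z denq_gt0.
Qed.

(** * The Khintchine system of a product of perfect sets *)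

Section ProductSystem.
Variables (R : realType) (n : nat) (Sf : 'I_n -> set R).
Hypothesis n_ge2 : (2 <= n)%N.
Hypothesis Sf_neq0 : forall k, Sf k !=set0.
Hypothesis Sf_perfect : forall k, perfect_subset (Sf k).
Hypothesis Sf_rational : forall k : 'I_n, (k < 2)%N ->
  dense_in (rationals R `&` Sf k) (Sf k).

Let S := cartesian Sf.

Lemma cartesian_compact : compact S.
Proof. by apply: (@rV_compact R n Sf) => k; have [] := Sf_perfect k. Qed.

Lemma cartesian_closed : closed S.
Proof. by apply: compact_closed cartesian_compact; exact: norm_hausdorff. Qed.

Lemma cartesian_neq0 : S !=set0.
Proof.
by have [x xS] := choice Sf_neq0; exists (\row_j x j) => j; rewrite mxE.
Qed.

Lemma cartesian_replace x k y : S x -> Sf k y -> S (replace x k y).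
Proof.
by move=> Sx Sy j; have [->|jk] := eqVneq j k; rewrite ?replaceE ?replace_neq.
Qed.

Lemma Sf_limit k z (y : R) : Sf k z -> closure (Sf k `\ y) z.
Proof.
apply: perfect_closureD; last exact: finite_set1.
- by apply: hausdorff_accessible; exact: Rhausdorff.
- by have [] := Sf_perfect k.
- by split => //; exact: subset_closure.
Qed.

Lemma other_axis (k : 'I_n) : exists2 j : 'I_n, (j < 2)%N & j != k.
Proof.
have n0 : (0 < n)%N by exact: ltnW.
have [k0|k0] := eqVneq (k : nat) 0%N.
  by exists (Ordinal n_ge2) => //; rewrite -val_eqE /= k0.
by exists (Ordinal n0) => //; rewrite -val_eqE /= eq_sym.
Qed.

Definition axis_index :=
  {p : 'I_n * rat | (p.1 < 2)%N && `[< Sf p.1 (ratr p.2) >]}.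

Definition axis_hyp (i : axis_index) := axis_hyperplane (val i).1 (val i).2.

Definition axis_slice (i : axis_index) := S `&` hyp_set R (axis_hyp i).

Lemma axis_indexP (k : 'I_n) (r : rat) : (k < 2)%N -> Sf k (ratr r) ->
  exists i : axis_index, val i = (k, r).
Proof.
move=> k2 kr; have H : (k < 2)%N && `[< Sf k (ratr r) >] by rewrite k2; exact/asboolP.
by exists (exist _ (k, r) H).
Qed.

Lemma axis_index_mem (i : axis_index) : Sf (val i).1 (ratr (val i).2).
Proof. by have /andP[_ /asboolP] := valP i. Qed.

Lemma axis_sliceE i :
  axis_slice i = S `&` [set x | x 0 (val i).1 = ratr (val i).2].
Proof. by rewrite /axis_slice hyp_set_axis. Qed.

(** Slices with different k differ because the coordinate k' varies on the
    slice {x_k = r}. *)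
Lemma axis_slice_inj : injective axis_slice.
Proof.
move=> i j; rewrite !axis_sliceE => eqL; apply: val_inj.
have [Si Sj] := (axis_index_mem i, axis_index_mem j).
move: eqL Si Sj; case: (val i) => k r; case: (val j) => k' r' /= eqL Si Sj.
have [x0 Sx0] := cartesian_neq0.
pose x := replace x0 k (ratr r).
have Sx : S x by exact: cartesian_replace.
have xk' : x 0 k' = ratr r'.
  suff : (S `&` [set x | x 0 k' = ratr r']) x by case.
  by rewrite -eqL; split => //=; rewrite replaceE.
have [kk'|kk'] := eqVneq k k'.
  move: xk'; rewrite -kk' replaceE => rr'; congr (_, _).
  exact: fmorph_inj rr'.
have [y [[Sy yr'] _]] :=
  Sf_limit (ratr r') Sj (@filterT _ _ (nbhs_filter (ratr r' : R))).
have : (S `&` [set x | x 0 k' = ratr r']) (replace x k' y).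
  rewrite -eqL; split; first exact: cartesian_replace.
  by rewrite /= replace_neq// replaceE.
by case=> _ /=; rewrite replaceE => /yr'.
Qed.

(** If the normal of B has a nonzero j-th entry with j <> k, then moving the
    j-th coordinate, which is possible as S_j has no isolated points, leaves B
    and stays in the slice. Otherwise B is orthogonal to the k-th axis, and it
    either misses the slice or cuts out exactly the slice. *)
Lemma inessential_hyp i (B : rat_hyperplane n) :
  S `&` hyp_set R B <> axis_slice i ->
  axis_slice i `<=` closure (axis_slice i `\` (S `&` hyp_set R B)).
Proof.
rewrite axis_sliceE; case: (val i) => k r /= neqB x [Sx xk].
have [Bx|nBx] := pselect (hyp_set R B x); last first.
  by apply: subset_closure; split=> // -[].
have [[j [jk Bj]]|axial] := pselect (exists j, j != k /\ normal B 0 j != 0).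
  apply: (closure_replace (Sf_limit (x 0 j) (Sx j))) => y [Sy yx].
  have {}yx : y != x 0 j by apply/eqP => yxj; exact: yx.
  split.
    split; first exact: cartesian_replace.
    by rewrite /= replace_neq// eq_sym.
  move=> [_]; rewrite /hyp_set /= dotp_replace Bx => /eqP.
  by rewrite -[X in _ == X]addr0 (inj_eq (addrI _)) mulf_eq0 subr_eq0
    (negPf yx) orbF mxE intr_eq0 (negPf Bj).
have Bj j : j != k -> normal B 0 j = 0.
  by move=> jk; apply/eqP; apply: contrapT => /negP Bj; apply: axial; exists j.
have Bk : (normal B 0 k)%:~R != 0 :> R.
  rewrite intr_eq0; apply: contraNneq (hyp_normal_neq0 B) => Bk.
  by apply/eqP/rowP => j; rewrite [RHS]mxE; have [->|/Bj] := eqVneq j k.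
have dotB (z : 'rV[R]_n) :
    dotp (int_vec R (normal B)) z = (normal B 0 k)%:~R * z 0 k.
  rewrite /dotp (bigD1 k)//= big1 ?addr0 => [|j jk]; first by rewrite mxE.
  by rewrite mxE Bj// mul0r.
exfalso; apply: neqB; congr (_ `&` _); apply/seteqP; split => z.
  rewrite /hyp_set /= -[X in _ = X -> _]Bx !dotB xk; exact: mulfI.
by move=> /= zr; rewrite /hyp_set /= -[RHS]Bx !dotB xk zr.
Qed.

(** The family L' consists of the sets S `&` B that are not slices. Hence a set
    of either family is nowhere dense in every slice different from it
    ([inessential_hyp]), which is the condition (c). *)
Theorem product_khintchine_system :
  exists (J : countType) (L' : J -> set 'rV[R]_n),
    khintchine_system S axis_slice L' axis_hyp.
Proof.
pose hyps := [set V | (exists B : rat_hyperplane n, V = S `&` hyp_set R B) /\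
                      ~ range axis_slice V].
have : countable hyps.
  apply: (@sub_countable _ _ _ ((fun m : 'rV[int]_n.+1 =>
    S `&` [set xi | dotp (int_vec R (normal m)) xi = (m 0 ord0)%:~R]) @` setT)).
    by apply: subset_card_le => _ [[B ->] _]; exists (hyp_vec B).
  exact: sub_countable (card_image_le _ _) _.
move=> /countable_enumeration[J [L' [L'inj L'range]]].
have L'P j : exists2 B : rat_hyperplane n, L' j = S `&` hyp_set R B &
    forall i, axis_slice i <> L' j.
  have [[B ->] nr] : hyps (L' j) by rewrite -L'range; exists j.
  by exists B => // i iB; apply: nr; exists i.
have cL i : closed (axis_slice i).
  by apply: closedI; [exact: cartesian_closed|exact: closed_hyp_set].
have cL' j : closed (L' j).
  have [B -> _] := L'P j.
  by apply: closedI; [exact: cartesian_closed|exact: closed_hyp_set].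
have in_closure i D : D `<=` axis_slice i -> axis_slice i `<=` closure D ->
    axis_slice i = closure_in S D.
  move=> Di iD; apply/seteqP; split=> x.
    by move=> ix; split; [exact: iD|case: ix].
  by case=> Dx _; exact/cL/(closureS Di).
exists J, L'; split.
- exact: axis_slice_inj.
- exact: L'inj.
- by move=> i j ij; have [B _ /(_ i)] := L'P j.
- by move=> i; exists (hyp_set R (axis_hyp i)) => //; exact: closed_hyp_set.
- move=> j; have [B -> _] := L'P j.
  by exists (hyp_set R B) => //; exact: closed_hyp_set.
- by move=> i x [].
- by move=> j; have [B -> _] := L'P j; exists B => x [].
- apply/seteqP; split=> [x [[i _ [Sx Ax]]|[j _]]|x [Sx [B Bx]]].
  + by split => //; exists (axis_hyp i).
  + by have [B -> _] := L'P j; case=> Sx Bx; split => //; exists B.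
  + have [[i _ iB]|nB] := pselect (range axis_slice (S `&` hyp_set R B)).
      by left; exists i => //; rewrite iB.
    have : hyps (S `&` hyp_set R B) by split => //; exists B.
    by rewrite -L'range => -[j _ jB]; right; exists j => //; rewrite jB.
- move=> i T T0; apply: in_closure => [x [j _ []]//|x ix].
  have [k' k'2 k'i] := other_axis (val i).1.
  have [Sx xi] := ix; rewrite hyp_set_axis /= in xi.
  have [_ iso] := Sf_perfect k'.
  have := dense_high_rationals T iso (Sf_rational k'2) (Sx k').
  move=> /closure_replace; apply => y [Sy [p yp pT]].
  have [j jp] : exists j : axis_index, val j = (k', p).
    by apply: axis_indexP; rewrite -?yp.
  have Sxy := cartesian_replace Sx Sy.
  exists j.
    by apply: lt_le_trans pT _; rewrite /axis_hyp jp; exact: height_axis.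
  rewrite !axis_sliceE jp /= -yp; split; split => //=; last by rewrite replaceE.
  by rewrite replace_neq// eq_sym.
- move=> i F F' Ffin F'fin nFi; apply: in_closure => [x []//|].
  apply: closureD_setU.
  + by apply: closed_bigcup => // j _; exact: cL.
  + apply: closureD_bigcup => // j Fj; split; first exact: cL.
    by apply: inessential_hyp => /axis_slice_inj ji; rewrite ji in Fj.
  + apply: closureD_bigcup => // j Fj; split; first exact: cL'.
    have [B L'B /(_ i)] := L'P j; rewrite L'B => neq.
    by apply: inessential_hyp => /esym.
- split=> [x [i _ []]//|x Sx].
  have k2 : ((Ordinal (ltnW n_ge2) : 'I_n) < 2)%N by [].
  apply: (closure_replace ((Sf_rational k2).2 _ (Sx _))) => y [[p _ py] Sy].
  have [j jp] : exists j : axis_index, val j = (Ordinal (ltnW n_ge2), p).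
    by apply: axis_indexP => //; rewrite py.
  exists j => //; rewrite axis_sliceE jp /=; split; first exact: cartesian_replace.
  by rewrite /= replaceE py.
Qed.

End ProductSystem.

(** * Exponentially singular points and the dual exponents *)

(** With u = ln t this is the inequality C * u <= exp (e * u), which holds for
    u >= 4 C / e^2 because exp (e * u) >= (e * u / 2)^2. *)
Lemma ln_le_powR_near (R : realType) (C e : R) : 0 < e ->
  \forall t \near +oo_R, C * ln t <= t `^ e.
Proof.
move=> e0; pose M := Num.max 0 (4 * C / e ^+ 2).
exists (expR M); split => [|t Mt]; first exact: num_real.
have t0 : 0 < t by apply: lt_trans Mt; exact: expR_gt0.
have : M <= ln t by rewrite -ler_expR lnK// ltW.
rewrite ge_max /powR gt_eqF// => /andP[u0]; rewrite ler_pdivrMr ?exprn_gt0//.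
set u := ln t in u0 *; move=> Cu.
have -> : e * u = e * u / 2 + e * u / 2 by lra.
rewrite expRD -expr2; apply: (@le_trans _ _ ((e * u / 2) ^+ 2)); last first.
  have eu0 : 0 <= e * u / 2 by rewrite divr_ge0// mulr_ge0// ltW.
  rewrite ler_sqr ?nnegrE ?expR_ge0//.
  by apply: le_trans (expR_ge1Dx _); rewrite lerDr.
nra.
Qed.

Lemma finite_set_bounded_int_vec n (N : nat) :
  finite_set [set q : 'rV[int]_n | forall j, (absz (q 0%R j) <= N)%N].
Proof.
pose vec (f : {ffun 'I_n -> 'I_(N.*2.+1)}) : 'rV[int]_n := \row_j ((f j)%:Z - N%:Z).
apply: (@sub_finite_set _ _ (vec @` setT)); last exact/finite_image/finite_finset.
move=> q /= qN; exists [ffun j => inord `|q 0%R j + N%:Z|] => //.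
apply/rowP => j; rewrite mxE ffunE inordK.
  by rewrite gez0_abs ?addrK//; have := qN j; lia.
by have := qN j; lia.
Qed.

Lemma finite_set_exp_norm_le (R : realType) n (C : R) :
  finite_set [set q : 'rV[int]_n | q != 0 /\ expR `|int_vec R q| <= C].
Proof.
apply: sub_finite_set (finite_set_bounded_int_vec n (Num.trunc C)) => q /= [_ qC] j.
have qj : (absz (q 0%R j))%:R <= C.
  rewrite natr_absz intr_norm; have := rV_entry_le_norm (int_vec R q) j.
  rewrite mxE => /le_trans; apply; apply: le_trans qC.
  by apply: le_trans (expR_ge1Dx _); rewrite lerDr.
by rewrite truncn_ge_nat// (le_trans _ qj).
Qed.

(** Here q = d e_k with d the denominator of r, so d <= |q| <= ln t and the
    linear form is d xi_k. *)
Definition axis_singular (R : realType) n (xi : 'rV[R]_n) : Prop :=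
  \forall t \near +oo_R, exists (k : 'I_n) (r : rat),
    let q := int_vec R (normal (axis_vec k r)) in
    expR `|q| <= t /\ dist_int (dotp q xi) <= expR (- t).

Lemma uncountably_many_axis_singular (R : realType) n (Sf : 'I_n -> set R) :
    (2 <= n)%N -> (forall k, Sf k !=set0) -> (forall k, perfect_subset (Sf k)) ->
    (forall k : 'I_n, (k < 2)%N -> dense_in (rationals R `&` Sf k) (Sf k)) ->
  uncountably_many (fun xi => [/\ cartesian Sf xi, totally_irrational xi &
                                  axis_singular xi]).
Proof.
move=> n2 S0 Sp SQ; have [J [L' khS]] := product_khintchine_system n2 S0 Sp SQ.
have := uncountably_many_singular (Phi := fun q => expR `|int_vec R q|)
  (phi := fun t => expR (- t)) khS (cartesian_compact Sp) (cartesian_neq0 S0).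
have finE C : 0 < C ->
    finite_set [set q : 'rV[int]_n | q != 0 /\ expR `|int_vec R q| <= C].
  by move=> _; exact: finite_set_exp_norm_le.
move=> /(_ (fun q _ => expR_gt0 _) finE (fun t _ => expR_gt0 _)) unc.
apply: uncountably_manyS (unc _) => [xi [Sxi irr sing]|t u _ tu]; last first.
  by rewrite ler_expR lerN2.
by split=> //; apply: filterS sing => t [i it]; exists (val i).1, (val i).2.
Qed.

Lemma ereal_sup_eqy (R : realType) (P : set R) :
  (forall g, 0 < g -> P g) -> ereal_sup [set g%:E | g in P] = +oo%E.
Proof.
move=> Pg; apply: hasNub_ereal_sup; last by exists 1; exact: Pg.
move=> [b bP]; have : Num.max b 0 + 1 <= b.
  by apply: bP; apply: Pg; rewrite ltr_wpDl// le_max lexx orbT.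
by rewrite leNgt ltr_pwDr// le_max lexx.
Qed.

(** The exponent G itself need not be attained, only every smaller one. *)
Lemma ereal_sup_ge_open (R : realType) (P : set R) (G : R) : 0 < G ->
  (forall g, 0 < g < G -> P g) -> (G%:E <= ereal_sup [set g%:E | g in P])%E.
Proof.
move=> G0 Pg; apply/lee_subgt0Pr => e e0.
pose g := Num.max (G - e) (G / 2).
have gP : P g.
  apply: Pg; rewrite lt_max gt_max; apply/andP; split; last lra.
  by apply/orP; right; rewrite divr_gt0.
apply: (@le_trans _ _ g%:E); first by rewrite -EFinB lee_fin le_max lexx.
by apply: ereal_sup_ubound; exists g.
Qed.

Lemma axis_singular_dual (R : realType) n (xi : 'rV[R]_n) :
  axis_singular xi -> omega_hat_dual xi = +oo%E.
Proof.
move=> sing; apply: ereal_sup_eqy => g g0; split => //.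
have growthg := @ln_le_powR_near R g 1 ltr01.
near=> t.
have t0 : 0 < t by near: t; exact: nbhs_pinfty_gt.
have [k [r [qt dt]]] : exists (k : 'I_n) (r : rat),
    let q := int_vec R (normal (axis_vec k r)) in
    expR `|q| <= t /\ dist_int (dotp q xi) <= expR (- t) by near: t.
exists (normal (axis_vec k r)); split.
  rewrite normr_gt0; apply/andP; split.
    apply/eqP => /rowP/(_ k)/eqP; rewrite mxE normal_axis eqxx mxE intr_eq0.
    by rewrite (negPf (denq_neq0 r)).
  by apply: le_trans qt; apply: le_trans (expR_ge1Dx _); rewrite lerDr.
apply: le_trans dt _; rewrite /powR gt_eqF// ler_expR mulNr lerN2.
have : g * ln t <= t `^ 1 by near: t.
by rewrite powRr1// ltW.
Unshelve. all: by end_near. Qed.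

Lemma min_weight_gt0 (R : realType) n (s : 'rV[R]_n) :
  weight s -> 0 < min_weight s.
Proof.
by move=> [s01 _]; apply: lt_bigmin => // j _; have /andP[] := s01 j.
Qed.

Lemma min_weight_le (R : realType) n (s : 'rV[R]_n) j : min_weight s <= s 0 j.
Proof. exact: bigmin_le. Qed.

(** The weighted size of q is at most |q|^(1/delta), and |q| <= ln t is
    eventually below t^delta. *)
Lemma axis_singular_dual_weighted (R : realType) n (s xi : 'rV[R]_n) :
  (0 < n)%N -> weight s -> axis_singular xi -> omega_hat_dual_w s xi = +oo%E.
Proof.
move=> n0 ws sing; apply: ereal_sup_eqy => g g0 /=.
have growths := @ln_le_powR_near R 1 _ (min_weight_gt0 ws).
have growthg := @ln_le_powR_near R g 1 ltr01.
near=> t.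
have t1 : 1 <= t by near: t; exact: nbhs_pinfty_ge.
have t0 : 0 < t by exact: lt_le_trans t1.
have t0' := ltW t0.
have [k [r [qt dt]]] : exists (k : 'I_n) (r : rat),
    let q := int_vec R (normal (axis_vec k r)) in
    expR `|q| <= t /\ dist_int (dotp q xi) <= expR (- t) by near: t.
exists (normal (axis_vec k r)); split.
  apply/andP; split.
    apply: lt_le_trans (le_bigmax _ _ k) => /=; apply: powR_gt0.
    by rewrite mxE normal_axis eqxx normr_gt0 intr_eq0 denq_neq0.
  apply: bigmax_le => [|j _]; first by rewrite exprn_ge0// ltW.
  have sj0 : 0 < s 0 j by have [/(_ j)/andP[]] := ws.
  apply: (@le_trans _ _ ((t `^ s 0 j) `^ (s 0 j)^-1)); last first.
    rewrite -powRrM mulfV ?gt_eqF// powRr1//.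
    by rewrite -[leLHS]expr1; exact: ler_weXn2l.
  apply: ge0_ler_powR; rewrite ?nnegrE ?powR_ge0//.
    by rewrite invr_ge0 ltW.
  apply: le_trans (rV_entry_le_norm _ _) _.
  apply: (@le_trans _ _ (ln t)); first by rewrite -ler_expR lnK.
  apply: (@le_trans _ _ (t `^ min_weight s)).
    by rewrite -[leLHS]mul1r; near: t.
  by apply: ler_powR => //; exact: min_weight_le.
apply: le_trans dt _; rewrite /powR gt_eqF// ler_expR mulNr lerN2.
have : g * ln t <= t `^ 1 by near: t.
by rewrite powRr1// ltW.
Unshelve. all: by end_near. Qed.

(** * Dirichlet's theorem and the simultaneous exponents *)

Lemma trunc_eq_dist_lt1 (R : realType) (x y : R) : 0 <= x -> 0 <= y ->
  Num.trunc x = Num.trunc y -> `|x - y| < 1.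
Proof.
move=> x0 y0 xy; have := truncn_itv x0; have := truncn_itv y0.
by rewrite xy -natr1 ltr_norml => /andP[? ?] /andP[? ?]; apply/andP; split; lra.
Qed.

(** Pigeonhole: the M + 1 multiples of theta with factors 0, ..., M fall into
    N_1 ... N_n = M boxes with sides 1 / N_j, so two of them share a box. *)
Lemma simultaneous_dirichlet (R : realType) n (theta : 'I_n -> R)
    (N : 'I_n -> nat) :
    (forall j, 0 < N j)%N ->
  exists m : nat, (0 < m <= \prod_j N j)%N /\
    forall j, dist_int (m%:R * theta j) <= (N j)%:R^-1.
Proof.
move=> N0; pose M := (\prod_j N j)%N.
pose frac (m : nat) j : R := m%:R * theta j - (Num.floor (m%:R * theta j))%:~R.
have frac0 m j : 0 <= frac m j by rewrite subr_ge0 floor_le.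
have frac1 m j : frac m j < 1.
  rewrite ltrBlDl; have /andP[_] := floor_itv (m%:R * theta j).
  by rewrite intrD addrC.
have NR j : 0 < (N j)%:R :> R by rewrite ltr0n.
have fracN0 m j : 0 <= frac m j * (N j)%:R by rewrite mulr_ge0.
have boxP m j : (Num.trunc (frac m j * (N j)%:R) < (N j).-1.+1)%N.
  by rewrite prednK// truncn_lt_nat// gtr_pMl.
pose box (m : 'I_M.+1) : {dffun forall j, 'I_(N j).-1.+1} :=
  [ffun j => Ordinal (boxP m j)].
have /injectivePn[m1 [m2 m12 boxE]] : ~~ injectiveb box.
  apply/negP => /injectiveP/leq_card; rewrite card_ord card_dep_ffun foldrE big_map.
  rewrite big_enum /= leqNgt => /negP; apply; rewrite ltnS /M.
  by apply: eq_leq; apply: eq_bigr => j _; rewrite card_ord prednK.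
have key (m m' : nat) : (m < m')%N -> (m' < M.+1)%N ->
    (forall j, Num.trunc (frac m j * (N j)%:R) =
               Num.trunc (frac m' j * (N j)%:R)) ->
  exists m : nat, (0 < m <= M)%N /\
    forall j, dist_int (m%:R * theta j) <= (N j)%:R^-1.
  move=> mm' m'M tE; exists (m' - m)%N; split.
    by rewrite subn_gt0 mm' /= (leq_trans (leq_subr _ _)).
  move=> j; apply: le_trans (dist_int_le _
    (Num.floor (m'%:R * theta j) - Num.floor (m%:R * theta j))) _.
  rewrite natrB 1?ltnW// intrB.
  have -> : (m'%:R - m%:R) * theta j - ((Num.floor (m'%:R * theta j))%:~R -
      (Num.floor (m%:R * theta j))%:~R) = frac m' j - frac m j :> R.
    by rewrite /frac; ring.
  rewrite -[leRHS]mul1r ler_pdivlMr// -{1}(gtr0_norm (NR j)) -normrM mulrBl.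
  by apply/ltW/trunc_eq_dist_lt1 => //; exact/esym/tE.
have tE j : Num.trunc (frac m1 j * (N j)%:R) = Num.trunc (frac m2 j * (N j)%:R).
  by have /ffunP/(_ j) := boxE; rewrite !ffunE => -[].
move: m12; rewrite neq_ltn => /orP[m12|m21]; first exact: (key m1 m2).
by apply: (key m2 m1) => // j; exact/esym/tE.
Qed.

(** With k and d as in [axis_singular], Dirichlet's theorem is applied to the
    numbers d xi_j with about t^(b s_j) boxes for j <> k, and boundedly many
    for k. Their total number is at most a constant times t^(b (1 - s_k)), an
    exponent smaller than 1, which leaves room for the factor d <= ln t. *)
Lemma axis_singular_simultaneous (R : realType) n (s xi : 'rV[R]_n) (b : R) :
    weight s -> axis_singular xi -> 0 < b -> b * (1 - min_weight s) < 1 ->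
  \forall t \near +oo_R, exists q : int, 0 < (q%:~R : R) <= t /\
    forall j, dist_int (q%:~R * xi 0 j) <= t `^ (- (b * s 0 j)).
Proof.
move=> [s01 s1] sing b0 b1.
have growth := @ln_le_powR_near R (1 + b) 1 ltr01.
have b1' : 0 < 1 - b * (1 - min_weight s) by rewrite subr_gt0.
have growth' := @ln_le_powR_near R (2 ^+ n) _ b1'.
near=> t.
have t1 : 1 <= t by near: t; exact: nbhs_pinfty_ge.
have t0 : 0 < t by exact: lt_le_trans t1.
have t0' := ltW t0.
have lnt0 : 0 <= ln t by exact: ln_ge0.
have [k [r [qt dt]]] : exists (k : 'I_n) (r : rat),
    let q := int_vec R (normal (axis_vec k r)) in
    expR `|q| <= t /\ dist_int (dotp q xi) <= expR (- t) by near: t.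
pose d := absz (denq r).
have dR : d%:R = (denq r)%:~R :> R.
  by rewrite natr_absz gtr0_norm ?denq_gt0.
have d0 : (0 < d)%N by rewrite absz_gt0 denq_neq0.
rewrite dotp_axis -dR in dt.
have dln : d%:R <= ln t.
  rewrite dR; apply: le_trans (height_axis R k r) _.
  by rewrite -ler_expR lnK.
(* There are about t^(e j) boxes in the direction j; the direction k is
   already taken care of by d. *)
pose e j := if j == k then 0 else b * s 0 j.
have e0 j : 0 <= e j.
  by rewrite /e; case: ifP => // _; rewrite mulr_ge0// ltW//; have /andP[] := s01 j.
pose N j := (Num.trunc (t `^ e j)).+1.
have Nlt j : t `^ e j < (N j)%:R by rewrite /N truncnS_gt.
have Nle j : (N j)%:R <= 2 * t `^ e j.
  have te1 : 1 <= t `^ e j by rewrite -(powRr0 t) ler_powR.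
  have /andP[tr _] := truncn_itv (ltW (lt_le_trans ltr01 te1)).
  by rewrite /N -natr1; lra.
have [m [/andP[m0 mN] dm]] :=
  simultaneous_dirichlet (fun j => d%:R * xi 0 j) (fun j => ltn0Sn _ : (0 < N j)%N).
have sume : \sum_j e j <= b * (1 - min_weight s).
  have -> : \sum_j e j = b * (1 - s 0 k).
    rewrite -s1 (bigD1 k)//= {1}/e eqxx add0r (bigD1 k (P := xpredT))//=.
    rewrite addrAC subrr add0r mulr_sumr; apply: eq_bigr => j jk.
    by rewrite /e (negPf jk).
  by rewrite ler_pM2l// lerB// min_weight_le.
have mle : m%:R <= 2 ^+ n * t `^ (b * (1 - min_weight s)).
  apply: (@le_trans _ _ (\prod_j (N j)%:R)); first by rewrite -natr_prod ler_nat.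
  apply: (@le_trans _ _ (\prod_j (2 * t `^ e j))).
    by apply: ler_prod => j _; rewrite Nle ler0n.
  rewrite big_split /= prodr_const card_ord ler_pM2l ?exprn_gt0//.
  have -> : \prod_j t `^ e j = t `^ (\sum_j e j).
    rewrite /powR gt_eqF// mulr_suml expR_sum; apply: eq_bigr => j _ //.
  exact: ler_powR.
(* q = d * m has to be at most t; the exponents of the two factors add up to 1. *)
have dmt : (d * m)%:R <= t.
  have E : t = t `^ (1 - b * (1 - min_weight s)) * t `^ (b * (1 - min_weight s)).
    by rewrite -powRD ?subrK ?powRr1// gt_eqF// implybT.
  have gt : 2 ^+ n * ln t <= t `^ (1 - b * (1 - min_weight s)) by near: t.
  rewrite natrM.
  apply: (@le_trans _ _ (ln t * (2 ^+ n * t `^ (b * (1 - min_weight s))))).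
    by apply: ler_pM.
  by rewrite {3}E mulrA (mulrC (ln t)) ler_wpM2r ?powR_ge0.
exists (d * m)%N%:Z; split; first by rewrite ltr0n muln_gt0 d0 m0 dmt.
move=> j; rewrite [_%:~R]natrM (mulrC d%:R) -mulrA.
have [->|jk] := eqVneq j k.
  apply: le_trans (dist_int_natmul _ _) _.
  apply: (@le_trans _ _ (t * expR (- t))).
    apply: ler_pM => //; first exact: dist_int_ge0.
    by apply: le_trans dmt; rewrite ler_nat leq_pmull.
  have gb : (1 + b) * ln t <= t `^ 1 by near: t.
  rewrite powRr1// in gb.
  rewrite -{1}(lnK t0) /powR gt_eqF// -expRD ler_expR.
  have sk : s 0 k <= 1 by have /andP[_ /ltW] := s01 k.
  have : b * s 0 k * ln t <= b * ln t.
    by rewrite ler_wpM2r// ger_pMr.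
  lra.
apply: le_trans (dm j) _; rewrite powRN lef_pV2 ?posrE ?powR_gt0//; apply: ltW.
by have := Nlt j; rewrite /e (negPf jk).
Unshelve. all: by end_near. Qed.

Lemma axis_singular_weighted (R : realType) n (s xi : 'rV[R]_n) :
    (0 < n)%N -> weight s -> axis_singular xi ->
  ((n%:R * (1 - min_weight s))^-1%:E <= omega_hat_w s xi)%E.
Proof.
move=> n0 ws sing; have [s01 _] := ws.
have nR : 0 < n%:R :> R by rewrite ltr0n.
have ms : 0 < 1 - min_weight s.
  rewrite subr_gt0; have /andP[_] := s01 (Ordinal n0).
  exact: le_lt_trans (min_weight_le _ _).
apply: ereal_sup_ge_open => [|g /andP[g0 gG]] /=; first by rewrite invr_gt0 mulr_gt0.
have ng0 : 0 < n%:R * g by rewrite mulr_gt0.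
have ng1 : n%:R * g * (1 - min_weight s) < 1.
  by rewrite mulrAC mulrC -lter_pdivlMr ?mulr_gt0// div1r.
have simul := axis_singular_simultaneous ws sing ng0 ng1.
near=> t.
have [q [qt qxi]] : exists q : int, 0 < (q%:~R : R) <= t /\
    forall j, dist_int (q%:~R * xi 0 j) <= t `^ (- (n%:R * g * s 0 j)) by near: t.
exists q; split => //; apply: bigmax_le => [|j _]; first exact: powR_ge0.
have sj0 : 0 < s 0 j by have /andP[] := s01 j.
rewrite !mxE ger0_norm ?dist_int_ge0//.
have -> : - (n%:R * g) = - (n%:R * g * s 0 j) * (s 0 j)^-1.
  by rewrite mulNr mulfK// gt_eqF.
rewrite powRrM; apply: ge0_ler_powR; rewrite ?nnegrE ?powR_ge0 ?dist_int_ge0//.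
by rewrite invr_ge0 ltW.
Unshelve. all: by end_near. Qed.

Lemma axis_singular_uniform (R : realType) n (xi : 'rV[R]_n) :
  (1 < n)%N -> axis_singular xi -> (((n%:R - 1)^-1)%:E <= omega_hat xi)%E.
Proof.
move=> n1 sing; have n0 : (0 < n)%N by exact: ltnW.
have nR : 0 < n%:R :> R by rewrite ltr0n.
have n1R : 1 < n%:R :> R by rewrite ltr1n.
pose s : 'rV[R]_n := const_mx n%:R^-1.
have ws : weight s.
  split => [j|]; first by rewrite mxE invr_gt0 nR invf_lt1.
  under eq_bigr do rewrite mxE.
  by rewrite sumr_const card_ord -[LHS]mulr_natr mulVf// gt_eqF.
have ms : n%:R^-1 <= min_weight s.
  by apply: le_bigmin => [|j _]; rewrite ?mxE// invf_le1// ltW.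
apply: ereal_sup_ge_open => [|g /andP[g0 gG]] /=; first by rewrite invr_gt0 subr_gt0.
split => //.
have ng0 : 0 < n%:R * g by rewrite mulr_gt0.
have ng1 : n%:R * g * (1 - min_weight s) < 1.
  apply: (@le_lt_trans _ _ (n%:R * g * (1 - n%:R^-1))).
    by rewrite ler_pM2l// lerB.
  have -> : n%:R * g * (1 - n%:R^-1) = g * (n%:R - 1).
    by rewrite mulrBr mulr1 mulrAC mulfV ?gt_eqF//; ring.
  by rewrite -lter_pdivlMr ?subr_gt0// div1r.
have simul := axis_singular_simultaneous ws sing ng0 ng1.
near=> t.
have [q [qt qxi]] : exists q : int, 0 < (q%:~R : R) <= t /\
    forall j, dist_int (q%:~R * xi 0 j) <= t `^ (- (n%:R * g * s 0 j)) by near: t.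
exists q; split => //; apply: rV_norm_le => [|j]; first exact: powR_ge0.
rewrite !mxE ger0_norm ?dist_int_ge0//; apply: le_trans (qxi j) _.
by rewrite mxE mulrAC mulfV ?mul1r ?gt_eqF.
Unshelve. all: by end_near. Qed.

(** * Products of perfect sets *)

Theorem theorem1p6 (R : realType) (n : nat) (hn : (2 <= n)%N)
    (Sf : 'I_n -> set R)
    (hS0 : forall k, Sf k !=set0)
    (hSp : forall k, perfect_subset (Sf k))
    (* the first two factors, indexed 0 and 1 *)
    (hSQ : forall k : 'I_n, (k < 2)%N ->
       dense_in (rationals R `&` Sf k) (Sf k)) :
  let S := cartesian Sf in
  [/\ S !=set0,
      locally_closed S &
      exists (I J : countType) (L : I -> set 'rV[R]_n) (L' : J -> set 'rV[R]_n)
             (A : I -> rat_hyperplane n),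
        khintchine_system S L L' A] /\
  [/\ forall (Phi : 'rV[int]_n -> R) (phi : R -> R),
        (forall q, q != 0 -> 0 < Phi q) ->
        (forall C : R, 0 < C -> finite_set [set q | q != 0 /\ Phi q <= C]) ->
        (forall t, 0 < t -> 0 < phi t) ->
        (forall t u, 0 < t -> t <= u -> phi u <= phi t) ->
        uncountably_many (fun xi : 'rV[R]_n =>
          [/\ S xi, totally_irrational xi &
              \forall t \near +oo_R, psi Phi xi t <= phi t]),
      uncountably_many (fun xi : 'rV[R]_n =>
        [/\ S xi, totally_irrational xi & omega_hat_dual xi = +oo%E]),
      uncountably_many (fun xi : 'rV[R]_n =>
        [/\ S xi, totally_irrational xi &
            ((((n%:R - 1)^-1)%:E : \bar R) <= omega_hat xi)%E]),
      forall s : 'rV[R]_n, weight s ->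
        uncountably_many (fun xi : 'rV[R]_n =>
          [/\ S xi, totally_irrational xi & omega_hat_dual_w s xi = +oo%E]) &
      forall s : 'rV[R]_n, weight s ->
        uncountably_many (fun xi : 'rV[R]_n =>
          [/\ S xi, totally_irrational xi &
              (((n%:R * (1 - min_weight s))^-1)%:E <= omega_hat_w s xi)%E])].
Proof.
have n0 : (0 < n)%N by exact: ltnW.
have compactS : compact (cartesian Sf) by exact: cartesian_compact.
have [J [L' khS]] := product_khintchine_system hn hS0 hSp hSQ.
have S0 := cartesian_neq0 hS0.
have unc := uncountably_many_axis_singular hn hS0 hSp hSQ.
split; split => //.
- exists setT; first exact: openT.
  by rewrite setIT; apply/closure_id; exact: cartesian_closed.
- by exists (axis_index Sf), J, (@axis_slice R n Sf), L', (@axis_hyp R n Sf).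
- move=> Phi phi Phi0 Phifin phi0 phimono.
  have := uncountably_many_singular khS compactS S0 Phi0 Phifin phi0 phimono.
  apply: uncountably_manyS => xi [Sxi irr sing]; split=> //.
  apply: filterS sing => t [i [Phit distt]]; apply: le_trans distt.
  apply: ge_inf; first by exists 0 => _ [q _ <-]; exact: dist_int_ge0.
  by exists (normal (axis_hyp i)) => //; split => //; exact: hyp_normal_neq0.
- apply: uncountably_manyS unc => xi [Sxi irr sing]; split=> //.
  exact: axis_singular_dual.
- apply: uncountably_manyS unc => xi [Sxi irr sing]; split=> //.
  exact: axis_singular_uniform.
- move=> s ws; apply: uncountably_manyS unc => xi [Sxi irr sing]; split=> //.
  exact: axis_singular_dual_weighted.
- move=> s ws; apply: uncountably_manyS unc => xi [Sxi irr sing]; split=> //.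
  exact: axis_singular_weighted.
Qed.
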